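(* Let $a(n)=a_{1+x+x^2,2}(n)$ be the number of accessible $n$-blocks for $1+x+x^2$ modulo $2$. Fix a real number $x$ with $\frac12\le x\le1$ and put $n=\lfloor 2^k/x\rfloor$. Then, as $k\to\infty$ (with $x$ fixed), $$\lim\frac{a(n)}{n^2}=\begin{cases}\displaystyle\frac54+\frac12x-\frac{5}{12}x^2 & \frac12\le x\le\frac23,\\[0.75em] \displaystyle\frac32-\frac14x+\frac{7}{48}x^2 & \frac23\le x\le 1.\end{cases}$$ Furthermore, $\displaystyle\limsup_{n\to\infty}\frac{a(n)}{n^2}=\frac75$ and $\displaystyle\liminf_{n\to\infty}\frac{a(n)}{n^2}=\frac{39}{28}$.
   Context: For a prime $p$ and a polynomial $f(x)$ with integer coefficients, ''row $i$'' is the string of coefficients of $f(x)^i$ reduced modulo $p$, ordered by increasing powers of $x$ (from $x^0$ up to $x^{\deg f^i}$). An $m$-block is a string of $m$ residues modulo $p$; it is accessible if it occurs as a substring of consecutive entries of row $i$ for some $i\ge0$. $a_{f,p}(m)$ is the number of accessible $m$-blocks, with the convention $a_{f,p}(0)=1$. *)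

(* Defs.v *)
From mathcomp Require Import all_boot all_order all_algebra.
From mathcomp Require Import all_classical all_reals all_analysis.
Set Implicit Arguments.
Unset Strict Implicit.
Unset Printing Implicit Defensive.
Import Order.TTheory GRing.Theory Num.Theory.
Import numFieldNormedType.Exports.

Local Open Scope classical_set_scope.
Local Open Scope ring_scope.

(* The power is taken over the integers before reduction, so the row runs up to
   the integral degree of f ^+ i and may end in zero residues. *)
Definition row_mod (f : {poly int}) (p i : nat) : seq 'F_p :=
  [seq c%:~R | c <- polyseq (f ^+ i)].

Definition accessible (f : {poly int}) (p : nat) (b : seq 'F_p) : Prop :=
  exists i : nat, infix b (row_mod f p i).

(* For m = 0 this is 1, as the empty block is an infix of every row. *)
Definition num_accessible (f : {poly int}) (p m : nat) : nat :=
  #|[set b : m.-tuple 'F_p | `[< accessible f b >]]%SET|.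

(* Main.v *)
(** Modulo 2, f(x)^(2i) = f^i(x^2) and f(x)^(2i+1) = (1 + x + x^2) f^i(x^2), so a
    block of length N comes from a unique shorter accessible block in one of four
    ways (parity of the row, parity of the starting position).  For N >= 6 the four
    families overlap only in the blocks 0, 10...0, 0...01 and the three
    nonzero blocks of period 3 satisfying s_(t+2) = s_t + s_(t+1); whence, with
    h = floor(N/2) and u = ceil(N/2),
      a(N) = a(u) + a(h) + a(u+1) + a(h+1) - 8.
    With K = 2^k this recurrence is solved exactly by two quadratic forms in
    (n, K), one for K <= n <= 3K/2 and one for 3K/2 <= n <= 2K, up to linear
    corrections depending on the parity of n.  Dividing by n^2 gives the limits at
    x = K/n; the extrema of the limit function are at x = 3/5 and x = 6/7. *)

Require Import Defs.
From mathcomp Require Import all_boot all_order all_algebra.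
From mathcomp Require Import all_classical all_reals all_analysis.
From mathcomp Require Import zify ring lra.
Import Order.TTheory GRing.Theory Num.Theory.
Import numFieldNormedType.Exports.

Set Implicit Arguments.
Unset Strict Implicit.

Local Open Scope classical_set_scope.
Local Open Scope ring_scope.

(** * Coefficients of the powers of the trinomial modulo 2 *)

Lemma F2_cases (x : 'F_2) : x = 0 \/ x = 1.
Proof.
by case: x => [[|[|//]] h]; [left|right]; apply/val_inj.
Qed.

Lemma F2_addrr (x : 'F_2) : x + x = 0.
Proof. by case: (F2_cases x) => ->; apply/val_inj. Qed.

Lemma F2_addr_eq0 (x y : 'F_2) : x + y = 0 -> x = y.
Proof.
by move=> xy; rewrite -[y]add0r -xy -addrA F2_addrr addr0.
Qed.

Definition tri (i : nat) : {poly 'F_2} := (1 + 'X + 'X^2) ^+ i.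

Lemma polyF2_addrr (p : {poly 'F_2}) : p + p = 0.
Proof. by apply/polyP => i; rewrite coefD coef0 F2_addrr. Qed.

Lemma polyF2_sqrD (p q : {poly 'F_2}) : (p + q) ^+ 2 = p ^+ 2 + q ^+ 2.
Proof. by rewrite sqrrD mulr2n polyF2_addrr addr0. Qed.

Lemma tri_double i : tri i.*2 = tri i \Po 'X^2.
Proof.
rewrite /tri -mul2n exprM rmorphXn /= !polyF2_sqrD expr1n.
by rewrite !rmorphD /= rmorph1 rmorphXn /= comp_polyX -!exprM.
Qed.

Lemma coef_tri_double i k :
  (tri i.*2)`_k = if odd k then 0 else (tri i)`_k./2.
Proof.
by rewrite tri_double coef_comp_poly_Xn // dvdn2 divn2; case: odd.
Qed.

(** Row [2 i + 1] is the trinomial times row [2 i], so its entry at [k + 2] adds the entries of row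
    [2 i] at [k], [k + 1], [k + 2], of which those at odd places vanish. Indexing from [k + 2] keeps
    all three places nonnegative. *)
Lemma coef_tri_doubleS i k :
  (tri i.*2.+1)`_k.+2 =
    if odd k then (tri i)`_(k./2).+1
    else (tri i)`_(k./2) + (tri i)`_(k./2).+1.
Proof.
rewrite /tri exprSr -/(tri _) !mulrDr mulr1 !coefD coefMX coefMXn /=.
rewrite !coef_tri_double /= negbK subSS subn1 /=.
rewrite uphalf_half -/(tri i).
by case: (odd k); rewrite ?addr0 ?add0r // addrC.
Qed.

Lemma tri_exp2 K : tri (2 ^ K) = 1 + 'X^(2 ^ K) + 'X^(2 * 2 ^ K).
Proof.
elim: K => [|K IH]; first by rewrite /tri expn0 muln1 !expr1.
rewrite expnSr /tri exprM -/(tri _) IH !polyF2_sqrD expr1n -!exprM.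
by rewrite -mulnA.
Qed.

Lemma size_trinomial_exp (R : idomainType) i :
  size ((1 + 'X + 'X^2 : {poly R}) ^+ i) = i.*2.+1.
Proof.
have sz : size (1 + 'X + 'X^2 : {poly R}) = 3%N.
  rewrite addrC size_polyDl ?size_polyXn // (leq_ltn_trans (size_polyD _ _)) //.
  by rewrite size_poly1 size_polyX.
have := size_exp (1 + 'X + 'X^2 : {poly R}) i; rewrite sz mul2n => <-.
by rewrite -polySpred // expf_neq0 // -size_poly_eq0 sz.
Qed.

(** By [tri_exp2], row [i + 2^K] consists of copies of row [i] at offsets 0, [2^K] and [2 * 2^K],
    disjoint because row [i] has at most [2^K] entries. This moves a block to a later start, and
    turns zeros read past the end of a row into genuine entries of a longer row. *)
Lemma coef_tri_shift i K l : (i.*2 < 2 ^ K)%N ->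
  (l < 2 ^ K)%N -> (tri (i + 2 ^ K))`_l = (tri i)`_l /\
  (tri (i + 2 ^ K))`_(2 ^ K + l) = (tri i)`_l.
Proof.
move=> iK lK; rewrite {1 3}/tri exprD -/(tri i) -/(tri _) tri_exp2.
have szP : size (tri i) = i.*2.+1 by rewrite /tri size_trinomial_exp.
rewrite !mulrDr mulr1 !coefD !coefMXn lK; split.
  by rewrite (_ : (l < 2 * 2 ^ K)%N) ?addr0 //; lia.
have -> : (2 ^ K + l < 2 ^ K)%N = false by lia.
have -> : (2 ^ K + l < 2 * 2 ^ K)%N by lia.
by rewrite addr0 addKn nth_default ?add0r // szP; lia.
Qed.

(* [s t] is read only for [t < N]; working with total functions avoids dependent
   tuple types. *)
Definition occ (N : nat) (s : nat -> 'F_2) : Prop :=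
  exists i j : nat, forall t : nat, (t < N)%N -> s t = (tri i)`_(j + t).

Lemma occ_ext {N s s'} : occ N s -> (forall t, (t < N)%N -> s t = s' t) -> occ N s'.
Proof. by move=> [i [j h]] e; exists i, j => t tN; rewrite -e // h. Qed.

Lemma occ_le {N} M {s} : (M <= N)%N -> occ N s -> occ M s.
Proof. by move=> MN [i [j h]]; exists i, j => t tM; rewrite h // (leq_trans tM). Qed.

(** A start of at least 2 makes [coef_tri_doubleS] applicable and leaves room to begin one place
    earlier in a doubled row. *)
Lemma occ_pos {N s} : occ N s ->
  exists i j : nat, forall t, (t < N)%N -> s t = (tri i)`_(j.+2 + t).
Proof.
move=> [i [j h]]; pose K := (j + N + i.*2).+1.
have ltK : (K < 2 ^ K)%N by rewrite ltn_expl.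
exists (i + 2 ^ K)%N, (2 ^ K + j - 2)%N => t tN.
rewrite h //; have -> : ((2 ^ K + j - 2).+2 + t = 2 ^ K + (j + t))%N by lia.
by case: (@coef_tri_shift i K (j + t)%N) => //; lia.
Qed.

Lemma nth_row_mod i j :
  nth 0 (row_mod (1 + 'X + 'X^2) 2 i) j = (tri i)`_j.
Proof.
have -> : tri i = map_poly intr ((1 + 'X + 'X^2 : {poly int}) ^+ i).
  by rewrite /tri rmorphXn /= !rmorphD rmorph1 /= map_polyX map_polyXn.
rewrite coef_map_id0 ?rmorph0 //.
have [ji|ji] := ltnP j (size ((1 + 'X + 'X^2 : {poly int}) ^+ i)).
  by rewrite (nth_map 0).
by rewrite !nth_default ?size_map.
Qed.

Lemma size_row_mod i : size (row_mod (1 + 'X + 'X^2) 2 i) = i.*2.+1.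
Proof. by rewrite size_map size_trinomial_exp. Qed.

Lemma accessibleE (b : seq 'F_2) :
  accessible (1 + 'X + 'X^2) b <-> occ (size b) (nth 0 b).
Proof.
split=> [[i /infixP [p [q e]]]|[i [j h]]].
  exists i, (size p) => t tb.
  by rewrite -nth_row_mod e nth_cat ltnNge leq_addr /= addKn nth_cat tb.
pose K := (j + size b + i.*2).+1.
have ltK : (K < 2 ^ K)%N by rewrite ltn_expl.
(* The window may run past the degree of row [i]; in row [i + 2^K] the first copy is followed by
   zeros up to place [2^K], so the whole window lies inside the row. *)
exists (i + 2 ^ K)%N.
have -> : b = take (size b) (drop j (row_mod (1 + 'X + 'X^2) 2 (i + 2 ^ K))).
  apply: (@eq_from_nth 'F_2 0) => [|t tb].
    by rewrite size_takel // size_drop size_row_mod; lia.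
  rewrite nth_take // nth_drop nth_row_mod h //.
  by case: (@coef_tri_shift i K (j + t)%N) => [||-> //]; lia.
apply/infixP; set r := row_mod _ _ _.
exists (take j r), (drop (size b) (drop j r)).
by rewrite !cat_take_drop.
Qed.

(** * Blocks of even and odd rows *)

(* A block of an even row has zeros in every other place ([evA], [evB]); a block
   of row [2 i + 1] alternates entries of row [i] with sums of two neighbours,
   starting with a sum ([evC]) or with an entry ([evD]). *)
Definition evA (c : nat -> 'F_2) (t : nat) : 'F_2 := if odd t then 0 else c t./2.
Definition evB (c : nat -> 'F_2) (t : nat) : 'F_2 := if odd t then c t./2 else 0.
Definition evC (c : nat -> 'F_2) (t : nat) : 'F_2 :=
  if odd t then c t./2.+1 else c t./2 + c t./2.+1.
Definition evD (c : nat -> 'F_2) (t : nat) : 'F_2 :=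
  if odd t then c t./2 + c t./2.+1 else c t./2.

Lemma occ_evA N c : occ (uphalf N) c -> occ N (evA c).
Proof.
move=> [i [j h]]; exists i.*2, j.*2 => t tN.
rewrite coef_tri_double oddD odd_double /= halfD odd_double add0n doubleK.
by rewrite /evA; case: ifP => // ot; rewrite h //; lia.
Qed.

Lemma occ_evB N c : occ N./2 c -> occ N (evB c).
Proof.
move=> /occ_pos [i [j h]]; exists i.*2, j.*2.+3 => t tN.
rewrite coef_tri_double !addSn /= oddD odd_double /= negbK.
rewrite /evB; case: ifP => // ot; rewrite h /=; last lia.
by congr (_`_ _); lia.
Qed.

Lemma occ_evC N c : occ (uphalf N).+1 c -> occ N (evC c).
Proof.
move=> [i [j h]]; exists i.*2.+1, j.*2.+2 => t tN.
rewrite !addSn coef_tri_doubleS oddD odd_double /= halfD odd_double add0n doubleK.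
by rewrite /evC; case: ifP => // ot; rewrite !h ?addnS //; lia.
Qed.

Lemma occ_evD N c : occ N./2.+1 c -> occ N (evD c).
Proof.
move=> /occ_pos [i [j h]]; exists i.*2.+1, j.*2.+4.+1 => t tN.
rewrite !addSn coef_tri_doubleS /= oddD odd_double /= negbK.
rewrite /evD; case: ifP => ot; rewrite !h /=; try lia.
  by congr (_`_ _ + _`_ _); lia.
by congr (_`_ _); lia.
Qed.

Definition img (ev : (nat -> 'F_2) -> nat -> 'F_2) (m N : nat) (s : nat -> 'F_2) :=
  exists2 c, occ m c & forall t, (t < N)%N -> s t = ev c t.

Lemma occ_split N s : occ N s <->
  (img evA (uphalf N) N s \/ img evB N./2 N s) \/
  (img evC (uphalf N).+1 N s \/ img evD N./2.+1 N s).
Proof.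
split.
  move=> /occ_pos [i [j h]].
  rewrite -[i]odd_double_half -[j]odd_double_half in h.
  move: (i./2) (j./2) h => i' j'.
  case: (odd i) (odd j) => [] [] h; [right; right|right; left|left; right|left; left].
  - exists (fun k => (tri i')`_(j'.+1 + k)); first by exists i', j'.+1.
    move=> t tN; rewrite h // !addSn coef_tri_doubleS /evD /= oddD odd_double /=.
    case: (odd t) (odd_double_half t) => /= e; last by congr (_`_ _); lia.
    by congr (_`_ _ + _`_ _); lia.
  - exists (fun k => (tri i')`_(j' + k)); first by exists i', j'.
    move=> t tN; rewrite h // !add0n !addSn coef_tri_doubleS /evC oddD odd_double /=.
    case: (odd t) (odd_double_half t) => /= e; first by congr (_`_ _); lia.
    by congr (_`_ _ + _`_ _); lia.
  - exists (fun k => (tri i')`_(j'.+2 + k)); first by exists i', j'.+2.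
    move=> t tN; rewrite h // !add0n coef_tri_double /evB !addSn /= oddD odd_double /=.
    case: (odd t) (odd_double_half t) => //= e.
    by congr (_`_ _); lia.
  - exists (fun k => (tri i')`_(j'.+1 + k)); first by exists i', j'.+1.
    move=> t tN; rewrite h // !add0n coef_tri_double /evA !addSn /= oddD odd_double /=.
    case: (odd t) (odd_double_half t) => //= e.
    by congr (_`_ _); lia.
move=> [[]|[]] [c oc e].
- by apply: (occ_ext (occ_evA oc)) => t tN; rewrite e.
- by apply: (occ_ext (occ_evB oc)) => t tN; rewrite e.
- by apply: (occ_ext (occ_evC oc)) => t tN; rewrite e.
- by apply: (occ_ext (occ_evD oc)) => t tN; rewrite e.
Qed.

(** * Some blocks that do or do not occur *)

Lemma occ_zero N s : (forall t, (t < N)%N -> s t = 0) -> occ N s.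
Proof.
move=> e; exists 0%N, 1%N => t tN.
by rewrite e // /tri expr0 coef1.
Qed.

Lemma occ_first N s :
  s 0%N = 1 -> (forall t, (0 < t < N)%N -> s t = 0) -> occ N s.
Proof.
move=> s0 e; exists 0%N, 0%N => -[|t] tN; rewrite /tri expr0 coef1 ?s0 //.
by rewrite e.
Qed.

Lemma occ_last N s :
  s N.-1 = 1 -> (forall t, (t < N.-1)%N -> s t = 0) -> occ N s.
Proof.
(* Row [2^N] has ones only at 0, [2^N] and [2 * 2^N]; the window ends exactly at the middle one and
   is too short to reach the first. *)
move=> s1 e; exists (2 ^ N)%N, (2 ^ N - N.-1)%N => t tN.
have ltN : (N < 2 ^ N)%N by rewrite ltn_expl.
rewrite tri_exp2 !coefD coef1 !coefXn.
have -> : (2 ^ N - N.-1 + t == 0)%N = false by lia.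
have -> : (2 ^ N - N.-1 + t == 2 * 2 ^ N)%N = false by lia.
rewrite add0r addr0; have [tN1|tN1] := eqVneq t N.-1.
  by rewrite tN1 s1 subnK ?eqxx //; lia.
have -> : (2 ^ N - N.-1 + t == 2 ^ N)%N = false by lia.
by rewrite e //; lia.
Qed.

(** The Fibonacci recurrence modulo 2 with free initial values: the zero sequence and the three
    shifts of the sequence of period 1, 1, 0. They form the overlap of the families [evC] and
    [evD]. *)
Fixpoint fib (x y : 'F_2) (t : nat) : 'F_2 :=
  if t is t'.+1 then fib y (x + y) t' else x.

Lemma fibE x y t : fib x y t.+2 = fib x y t + fib x y t.+1.
Proof. by elim: t x y => //= t IH x y; rewrite -IH. Qed.

Lemma fib_period s : (forall t, s t.+2 = s t + s t.+1 :> 'F_2) ->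
  forall t, s t.+3 = s t.
Proof. by move=> h t; rewrite !h addrCA F2_addrr addr0. Qed.

Lemma fib_double s : (forall t, s t.+2 = s t + s t.+1 :> 'F_2) ->
  forall t, s t.*2.+1 = s t.*2 + s t.*2.+2.
Proof. by move=> h t; rewrite h addrA F2_addrr add0r. Qed.

(** In characteristic 2 the recurrence also reads [s (2k+1) = s (2k) + s (2k+2)], so inserting sums
    of neighbours into the even-indexed subsequence restores [s]. By [fib_half] that subsequence is
    again Fibonacci. *)
Lemma evD_fib s : (forall t, s t.+2 = s t + s t.+1) ->
  forall t, evD (fun k => s k.*2) t = s t.
Proof.
move=> h t; rewrite /evD; case: ifP => ot; last by congr s; lia.
by rewrite doubleS -fib_double //; congr s; lia.
Qed.

Lemma evC_fib s : (forall t, s t.+2 = s t + s t.+1) ->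
  forall t, evC (fun k => s k.*2.+2) t = s t.
Proof.
move=> h t; have p := fib_period h.
rewrite /evC doubleS p; case: ifP => ot; first by congr s; lia.
by rewrite addrC -h p; congr s; lia.
Qed.

Lemma fib_half s : (forall t, s t.+2 = s t + s t.+1 :> 'F_2) ->
  forall t, s t.+2.*2 = s t.*2 + s t.+1.*2.
Proof. by move=> h t; rewrite !doubleS (fib_period h) fib_double. Qed.

Lemma occ_fib N s : (forall t, s t.+2 = s t + s t.+1) -> occ N s.
Proof.
elim/ltn_ind: N s => N IH s h.
(* The induction passes from length [N] to [N./2.+1], which is smaller only from [N = 3] on. *)
have [N2|N2] := leqP N 2.
  apply: (@occ_le 2) => //.
  case: (F2_cases (s 0%N)) (F2_cases (s 1%N)) => s0 [] s1.
  - by apply: occ_zero => -[|[|]].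
  - by apply: occ_last => //= -[|[|]].
  - by apply: occ_first => //= -[|[|]].
  - exists 1%N, 0%N => -[|[|]] // _; rewrite ?s0 ?s1 /tri expr1;
    by rewrite !coefD coef1 coefX coefXn /= ?addr0 ?add0r.
apply: (occ_ext (occ_evD (_ : occ _ (fun k => s k.*2)))) => [|t tN].
  by apply: IH => [|t]; [lia|exact: (fib_half h)].
exact: evD_fib.
Qed.

Lemma occ3 s : occ 3 s.
Proof.
case: (F2_cases (s 0%N)) (F2_cases (s 1%N)) (F2_cases (s 2%N)) => s0 [] s1 [] s2.
- by apply: occ_zero => -[|[|[|]]].
- by apply: occ_last => //= -[|[|[|]]].
- apply/occ_split; left; right; exists (fun=> 1).
    by apply: occ_first => // -[].
  by move=> [|[|[|]]].
- by apply: occ_ext (occ_fib 3 (@fibE 0 1)) _ => -[|[|[|]]] //= _;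
  rewrite ?s0 ?s1 ?s2 ?add0r.
- by apply: occ_first => //= -[|[|[|]]].
- by apply: occ_ext (occ_fib 3 (@fibE 1 0)) _ => -[|[|[|]]] //= _;
  rewrite ?s0 ?s1 ?s2 ?addr0.
- apply: occ_ext (occ_fib 3 (@fibE 1 1)) _ => -[|[|[|]]] //= _; rewrite ?s0 ?s1 ?s2 //.
  exact: F2_addrr.
- exists 1%N, 0%N => -[|[|[|]]] // _; rewrite ?s0 ?s1 ?s2 /tri expr1;
  by rewrite !coefD coef1 coefX coefXn /= ?addr0 ?add0r.
Qed.

(** The block 1111 never occurs: even rows vanish at every other place, and in an odd row a sum
    lying between two entries equal to 1 is 0. *)
Lemma occ_ones4 s : occ 4 s -> (forall t, (t < 4)%N -> s t = s 0%N) -> s 0%N = 0.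
Proof.
move=> /occ_split oc e; have [//|s1] := F2_cases (s 0%N); exfalso.
have {}e t : (t < 4)%N -> s t = 1 by move=> /e ->.
have /eqP := oner_neq0 'F_2; apply.
have e0 := e 0%N isT; have e1 := e 1%N isT; have e2 := e 2%N isT.
have e3 := e 3%N isT.
case: oc => -[] [c _ h]; move: (h 0%N isT) (h 1%N isT) (h 2%N isT) (h 3%N isT);
  rewrite e0 e1 e2 e3 /evA /evB /evC /evD /=.
- by [].
- by [].
- by move=> _ c1 + c2; rewrite -c1 -c2 F2_addrr.
- by move=> c0 + c1; rewrite -c0 -c1 F2_addrr.
Qed.

Lemma occ_const N s : (4 <= N)%N -> occ N s ->
  (forall t, (t.+1 < N)%N -> s t.+1 = s t) -> forall t, (t < N)%N -> s t = 0.
Proof.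
move=> N4 oc h.
have e t : (t < N)%N -> s t = s 0%N.
  by elim: t => // t IH tN; rewrite h // IH // ltnW.
move=> t tN; rewrite e //; apply: (occ_ones4 (occ_le N4 oc)) => u u4.
by rewrite e // (leq_trans u4).
Qed.

(** Two ones cannot enclose an even number [g >= 2] of zeros. In an even row, ones lie at an even
    distance. In an odd row, an end that is an entry, next to a sum equal to 0, forces the
    neighbouring entry to be 1, yet that entry is among the zeros. This excludes 10...01 from the
    overlap of [evA] and [evC]. *)
Lemma occ_gap g s : (1 < g)%N -> ~~ odd g -> occ g.+2 s ->
  s 0%N = 1 -> s g.+1 = 1 -> (forall t, (0 < t <= g)%N -> s t = 0) -> False.
Proof.
move=> g1 og /occ_split oc s0 sg e.
have g2 : (g./2.*2 = g)%N by rewrite even_halfK.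
have e1 := e 1%N (ltnW g1); have e2 := e 2%N g1.
case: oc => -[] [] c _ h.
- by move: (h g.+1 (ltnSn _)); rewrite sg /evA /= og.
- by move: (h 0%N isT); rewrite s0.
- have := h g.+1 (ltnSn _); rewrite sg /evC /= og uphalf_half (negbTE og) add0n => cg.
  have := h g (leqW (ltnSn _)); rewrite e ?leqnn ?(ltnW g1) // /evC (negbTE og) -cg.
  have := h g.-1; rewrite e; last lia.
  rewrite /evC; have -> : odd g.-1 by lia.
  have -> : (g.-1./2.+1 = g./2)%N by lia.
  move=> <-; last lia.
  by rewrite add0r.
- have := h 0%N isT; have := h 1%N (leqW (ltnW g1)); have := h 2%N (leqW g1).
  rewrite s0 e1 e2 /evD /= => <- + c0; rewrite -c0 addr0 => /esym/eqP.
  by rewrite oner_eq0.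
Qed.

(** * The four families of blocks and their overlaps *)

Definition blocks N : {set N.-tuple 'F_2} :=
  [set s : N.-tuple 'F_2 | `[< occ N (nth 0 s) >]]%SET.

Lemma blocksP N (s : N.-tuple 'F_2) : reflect (occ N (nth 0 s)) (s \in blocks N).
Proof. by rewrite inE; apply: asboolP. Qed.

Lemma num_accessibleE N : num_accessible (1 + 'X + 'X^2) 2 N = #|blocks N|.
Proof.
apply: eq_card => s; rewrite !inE; apply: asbool_equiv_eq.
by rewrite accessibleE size_tuple.
Qed.

Definition imgs ev m N : {set N.-tuple 'F_2} :=
  [set s : N.-tuple 'F_2 | `[< img ev m N (nth 0 s) >]]%SET.

Lemma imgsP ev m N (s : N.-tuple 'F_2) :
  reflect (img ev m N (nth 0 s)) (s \in imgs ev m N).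
Proof. by rewrite inE; apply: asboolP. Qed.

(** From left to right this is injectivity; from right to left it says that a window of length [N]
    depends only on the first [m] entries. Together they make [m] the exact length of the source
    block. *)
Definition faithful (ev : (nat -> 'F_2) -> nat -> 'F_2) m N := forall c c',
  (forall t, (t < N)%N -> ev c t = ev c' t) <->
  (forall k, (k < m)%N -> c k = c' k).

Lemma card_imgs ev m N : faithful ev m N -> #|imgs ev m N| = #|blocks m|.
Proof.
move=> fev; pose f (c : m.-tuple 'F_2) := [tuple of mkseq (ev (nth 0 c)) N].
have -> : imgs ev m N = (f @: blocks m)%SET.
  apply/setP => s; apply/imgsP/imsetP => [[c oc e]|[c]].
    exists [tuple of mkseq c m].
      by apply/blocksP; apply: (occ_ext oc) => t tm; rewrite /= nth_mkseq.
    apply/val_inj => /=; apply: (@eq_from_nth 'F_2 0) => [|t].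
      by rewrite size_tuple size_mkseq.
    rewrite size_tuple => tN; rewrite nth_mkseq // e //.
    by have [_ h] := fev c (nth 0 (mkseq c m)); apply: h => // k km; rewrite nth_mkseq.
  move=> /blocksP oc ->; exists (nth 0 c) => // t tN.
  by rewrite nth_mkseq.
apply: card_in_imset => c c' _ _ /(congr1 val) e.
apply/val_inj/(@eq_from_nth 'F_2 0) => [|k]; first by rewrite !size_tuple.
rewrite size_tuple => km.
have [h _] := fev (nth 0 c) (nth 0 c'); apply: h => // t tN.
by have := congr1 (fun b => nth 0 b t) e; rewrite /= !nth_mkseq.
Qed.

Lemma faithful_evA N : faithful evA (uphalf N) N.
Proof.
move=> c c'; split=> h k kN; last by rewrite /evA; case: ifP => // ok; rewrite h //; lia.
by have := h k.*2; rewrite /evA odd_double doubleK; apply; lia.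
Qed.

Lemma faithful_evB N : faithful evB N./2 N.
Proof.
move=> c c'; split=> h k kN; last by rewrite /evB; case: ifP => // ok; rewrite h //; lia.
have := h k.*2.+1; rewrite /evB /= odd_double /= uphalf_double; apply; lia.
Qed.

(** The sums at even places determine each entry of [c] from its neighbour; the entry [c 1], visible
    at place 1 once [N > 1], anchors the chain. *)
Lemma faithful_evC N : (1 < N)%N -> faithful evC (uphalf N).+1 N.
Proof.
move=> N1 c c'; split=> h.
  have e1 : c 1%N = c' 1%N by have := h 1%N N1.
  elim=> [|k IH] kN.
    by have := h 0%N (ltnW N1); rewrite /evC /= e1 => /addIr.
  have := h k.*2; rewrite /evC odd_double doubleK IH; last lia.
  by move=> hk; apply: (@addrI _ (c' k)); apply: hk; lia.
by move=> t tN; rewrite /evC; case: ifP => ot; rewrite !h //; lia.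
Qed.

Lemma faithful_evD N : (0 < N)%N -> faithful evD N./2.+1 N.
Proof.
move=> N0 c c'; split=> h.
  elim=> [|k IH] kN; first by have := h 0%N N0.
  have := h k.*2.+1; rewrite /evD /= odd_double /= uphalf_double IH; last lia.
  by move=> hk; apply: (@addrI _ (c' k)); apply: hk; lia.
by move=> t tN; rewrite /evD; case: ifP => ot; rewrite !h //; lia.
Qed.

Lemma blocks_split N : blocks N =
  ((imgs evA (uphalf N) N :|: imgs evB N./2 N) :|:
   (imgs evC (uphalf N).+1 N :|: imgs evD N./2.+1 N))%SET.
Proof.
apply/setP => s; rewrite !inE -!asbool_or.
exact/asbool_equiv_eq/occ_split.
Qed.

Section Intersections.
Variables (N : nat) (s : nat -> 'F_2).
Hypothesis N6 : (6 <= N)%N.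

Lemma img_AB : img evA (uphalf N) N s -> img evB N./2 N s ->
  forall t, (t < N)%N -> s t = 0.
Proof.
move=> [c _ h] [d _ h'] t tN.
by have := h t tN; have := h' t tN; rewrite /evA /evB; case: odd.
Qed.

(** The odd places, zero in [evA], are sums of neighbours in [evD], so [d] is constant; its length
    is at least 4 because [N >= 6], and [occ_const] makes it zero. [img_BC] is the same with
    parities exchanged. *)
Lemma img_AD : img evA (uphalf N) N s -> img evD N./2.+1 N s ->
  forall t, (t < N)%N -> s t = 0.
Proof.
move=> [c _ h] [d od h'].
have d0 : forall k, (k < N./2.+1)%N -> d k = 0.
  apply: occ_const od _ => [|k kN]; first lia.
  have kN' : (k.*2.+1 < N)%N by lia.
  have := h' k.*2.+1 kN'; rewrite h // /evA /evD /= odd_double /= uphalf_double.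
  by move=> /esym/F2_addr_eq0.
by move=> t tN; rewrite h' // /evD; case: ifP => ot; rewrite !d0 ?addr0 //; lia.
Qed.

Lemma img_BC : img evB N./2 N s -> img evC (uphalf N).+1 N s ->
  forall t, (t < N)%N -> s t = 0.
Proof.
move=> [c _ h] [d od h'].
have d0 : forall k, (k < (uphalf N).+1)%N -> d k = 0.
  apply: occ_const od _ => [|k kN]; first lia.
  have kN' : (k.*2 < N)%N by lia.
  have := h' k.*2 kN'; rewrite h // /evB /evC /= odd_double /= doubleK.
  by move=> /esym/F2_addr_eq0.
by move=> t tN; rewrite h' // /evC; case: ifP => ot; rewrite !d0 ?addr0 //; lia.
Qed.

(** The even places show the entries of [d], which therefore vanish. For even [N] the last place
    also involves [d N./2], seen nowhere else, so it stays free. *)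
Lemma img_BD : img evB N./2 N s -> img evD N./2.+1 N s ->
  forall t, (t < N.-1)%N -> s t = 0.
Proof.
move=> [c _ h] [d od h'].
have d0 k : (k.*2 < N)%N -> d k = 0.
  by move=> kN; have := h' _ kN; rewrite h // /evB /evD odd_double doubleK.
move=> t tN; rewrite h' /evD; last lia.
by case: ifP => ot; rewrite !d0 ?addr0 //; lia.
Qed.

(** The odd places show [d 1] up to [d N./2], which vanish; only the two ends of [s] remain free,
    and they cannot both be 1. *)
Lemma img_AC : img evA (uphalf N) N s -> img evC (uphalf N).+1 N s ->
  (forall t, (0 < t < N.-1)%N -> s t = 0) /\ (s 0%N = 0 \/ s N.-1 = 0).
Proof.
move=> [c oc h] [d od h'].
have d0 k : (0 < k <= N./2)%N -> d k = 0.
  move=> kN; have := h' k.-1.*2.+1; rewrite h; last lia.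
  rewrite /evA /evC /= odd_double /= uphalf_double prednK; last lia.
  by move=> <- //; lia.
have s0 t : (0 < t < N.-1)%N -> s t = 0.
  move=> tN; rewrite h' /evC; last lia.
  by case: ifP => ot; rewrite !d0 ?addr0 //; lia.
split=> //.
have [|s01] := F2_cases (s 0%N); first by left.
have [|s11] := F2_cases (s N.-1); first by right.
have N0 : (N.-1 < N)%N by lia.
have oN : odd N.
  by move: (h _ N0); rewrite s11 /evA; case: ifP => // oN _; lia.
(* Here [c] and [d] both have the shape 10...01, with [N./2 - 1] and [N./2] inner zeros. One of
   these numbers is even, against [occ_gap]. *)
exfalso; have [og|og] := boolP (odd N./2).
  apply: (@occ_gap N./2.-1 c); try lia.
  - by rewrite (_ : N./2.-1.+2 = uphalf N) //; lia.
  - by have := h 0%N; rewrite s01 => /(_ (leq_ltn_trans (leq0n _) N0)).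
  - have := h _ N0; rewrite s11 /evA; case: ifP => [|_ ->]; first lia.
    by congr c; lia.
  - move=> t tN; have := h t.*2; rewrite s0; last lia.
    by rewrite /evA odd_double doubleK => <- //; lia.
apply: (@occ_gap N./2 d); try lia.
- by rewrite (_ : N./2.+2 = (uphalf N).+1) //; lia.
- have := h' 0%N; rewrite s01 /evC /= (d0 1%N) ?addr0; last lia.
  by move=> /(_ (leq_ltn_trans (leq0n _) N0)).
- have := h' _ N0; rewrite s11 /evC; case: ifP => [|_]; first lia.
  rewrite d0 ?add0r; last lia.
  by move=> ->; congr d; lia.
- exact: d0.
Qed.

(** Sums sit at even places in [evC] and at odd places in [evD], so any three consecutive places
    read [x], [x + y], [y] in one of the two descriptions. *)
Lemma img_CD : img evC (uphalf N).+1 N s -> img evD N./2.+1 N s ->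
  forall t, (t.+2 < N)%N -> s t.+2 = s t + s t.+1.
Proof.
move=> [c _ h] [d _ h'] t tN.
have tN1 := ltnW tN; have tN0 := ltnW tN1.
have [ot|ot] := boolP (odd t).
  have := h _ tN0; have := h _ tN; have := h _ tN1.
  rewrite /evC /= ot /= uphalf_half ot add1n => -> -> ->.
  by rewrite addrA F2_addrr add0r.
have := h' _ tN0; have := h' _ tN; have := h' _ tN1.
rewrite /evD /= (negbTE ot) /= uphalf_half (negbTE ot) add0n => -> -> ->.
by rewrite addrA F2_addrr add0r.
Qed.

End Intersections.

(** * The recurrence and its initial values *)

Section Recurrence.
Variable N : nat.
Hypothesis N6 : (6 <= N)%N.

Let tup (s : nat -> 'F_2) := [tuple of mkseq s N].
Let zero := tup (fun=> 0).
Let first := tup (fun t => (t == 0%N)%:R).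
Let last := tup (fun t => (t == N.-1)%:R).

Let tupE s t : (t < N)%N -> nth 0 (tup s) t = s t.
Proof. by move=> tN; rewrite /= nth_mkseq. Qed.

Let eq_tup (b : N.-tuple 'F_2) s :
  (forall t, (t < N)%N -> nth 0 b t = s t) -> b = tup s.
Proof.
move=> e; apply/val_inj/(@eq_from_nth 'F_2 0); first by rewrite !size_tuple.
by move=> t; rewrite size_tuple => tN; rewrite e ?tupE.
Qed.

Let img_tup ev m (s c : nat -> 'F_2) :
  occ m c -> (forall t, (t < N)%N -> s t = ev c t) -> tup s \in imgs ev m N.
Proof.
by move=> oc e; apply/imgsP; exists c => // t tN; rewrite tupE ?e.
Qed.

Lemma card_imgs_AB : #|imgs evA (uphalf N) N :&: imgs evB N./2 N|%SET = 1%N.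
Proof.
apply: etrans (cards1 zero); congr #|pred_of_set _|; apply/setP => s.
rewrite finset.in_setI finset.in_set1; apply/andP/eqP => [[/imgsP A /imgsP B]|->].
  by apply: eq_tup; exact: (img_AB A B).
by split; apply: (img_tup (c := fun=> 0)); rewrite ?/evA ?/evB;
  try (by apply: occ_zero); move=> t _; case: odd.
Qed.

Lemma card_imgs_CD : #|imgs evC (uphalf N).+1 N :&: imgs evD N./2.+1 N|%SET = 4%N.
Proof.
pose f (x : 'F_2 * 'F_2) := tup (fib x.1 x.2).
have f_inj : injective f.
  move=> [x y] [x' y'] /(congr1 (fun b => (nth 0 (val b) 0, nth 0 (val b) 1))).
  by rewrite /f !tupE //; lia.
have <- : #|(f @: [set: 'F_2 * 'F_2])%SET| = 4%N.
  by rewrite card_imset // cardsT card_prod card_ord.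
congr #|pred_of_set _|; apply/setP => s; rewrite finset.in_setI.
apply/andP/imsetP => [[/imgsP C /imgsP D]|[[x y] _ ->]].
  exists (nth 0 s 0, nth 0 s 1) => //; apply: eq_tup.
  have h t : ((t < N)%N -> nth 0 s t = fib (nth 0 s 0) (nth 0 s 1) t) /\
      ((t.+1 < N)%N -> nth 0 s t.+1 = fib (nth 0 s 0) (nth 0 s 1) t.+1).
    elim: t => [|t [h h']]; first by split.
    split=> // tN; rewrite fibE (img_CD C D) // h ?h' //; lia.
  by move=> t; case: (h t).
have E := @fibE x y; split.
  apply: (img_tup (c := fun k => fib x y k.+1.*2)).
    by apply: occ_fib => t; exact: (fib_half E t.+1).
  by move=> t _; rewrite (evC_fib E).
apply: (img_tup (c := fun k => fib x y k.*2)).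
  by apply: occ_fib => t; exact: (fib_half E).
by move=> t _; rewrite (evD_fib E).
Qed.

(** The common blocks are 0, 10...0 and 0...01: [img_AD] and [img_BC] leave only 0, [img_AC] leaves
    at most one nonzero end, [img_BD] at most the last place. *)
Lemma card_imgs_ABCD :
  #|(imgs evA (uphalf N) N :|: imgs evB N./2 N) :&:
    (imgs evC (uphalf N).+1 N :|: imgs evD N./2.+1 N)|%SET = 3%N.
Proof.
have N1 : (N.-1 < N)%N by lia.
have N0 : (0 < N)%N by lia.
have neq (s s' : nat -> 'F_2) t : (t < N)%N -> s t != s' t -> tup s != tup s'.
  move=> tN; apply: contraNneq => /(congr1 (fun b => nth 0 (val b) t)).
  by rewrite !tupE // => ->.
have <- : #|[set zero; first; last]%SET| = 3%N.
  have z0 : (0%N == N.-1) = false by lia.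
  have z1 : (N.-1 == 0)%N = false by lia.
  have lz : last != zero by apply: (@neq _ _ N.-1) => //; rewrite eqxx.
  have lf : last != first by apply: (@neq _ _ 0%N) => //; rewrite z0 eq_sym.
  have zf : zero != first by apply: (@neq _ _ 0%N) => //; rewrite eqxx eq_sym.
  by rewrite finset.setUC cardsU1 cards2 finset.in_set2 negb_or lz lf zf.
congr #|pred_of_set _|; apply/setP => s; rewrite finset.in_setI.
apply/andP/idP => [[/finset.setUP AB /finset.setUP CD]|].
  have [s0 s1] : (forall t, (0 < t < N.-1)%N -> nth 0 s t = 0) /\
      (nth 0 s 0 = 0 \/ nth 0 s N.-1 = 0).
    case: AB CD => /imgsP AB [] /imgsP CD.
    - exact: (img_AC N6 AB CD).
    - have e := img_AD N6 AB CD; split=> [t tN|]; last by left; rewrite e.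
      by rewrite e //; lia.
    - have e := img_BC N6 AB CD; split=> [t tN|]; last by left; rewrite e.
      by rewrite e //; lia.
    - have e := img_BD N6 AB CD; split=> [t tN|]; last by left; rewrite e //; lia.
      by rewrite e //; lia.
  have e (b : nat -> 'F_2) : nth 0 s 0 = b 0%N -> nth 0 s N.-1 = b N.-1 ->
      (forall t, (0 < t < N.-1)%N -> b t = 0) -> s = tup b.
    move=> b0 b1 bt; apply: eq_tup => -[//|t] tN.
    have [->//|tN1] := eqVneq t.+1 N.-1.
    by rewrite s0 ?bt //; lia.
  rewrite !inE; apply/orP.
  have [f0|f0] := F2_cases (nth 0 s 0); have [f1|f1] := F2_cases (nth 0 s N.-1).
  - by left; apply/orP; left; apply/eqP/e.
  - right; apply/eqP/e; rewrite ?f0 ?f1 ?eqxx //.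
      by rewrite (_ : (_ == _) = false) //; lia.
    by move=> t tN; rewrite (_ : (_ == _) = false) //; lia.
  - left; apply/orP; right; apply/eqP/e; rewrite ?f0 ?f1 ?eqxx //.
      by rewrite (_ : (_ == _) = false) //; lia.
    by move=> t tN; rewrite (_ : (_ == _) = false) //; lia.
  - by case: s1 => h; [move: f0|move: f1]; rewrite h => /esym/eqP; rewrite oner_eq0.
rewrite !finset.in_setU !finset.in_set1 => /orP[/orP[]|] /eqP ->.
- split; apply/orP; left; apply: (img_tup (c := fun=> 0)); try by apply: occ_zero.
  + by move=> t _; rewrite /evA; case: odd.
  + by move=> t _; rewrite /evC addr0; case: odd.
- split; apply/orP; left; apply: (img_tup (c := fun t => (t == 0%N)%:R));
    try by apply: occ_first => // -[|t].
  + move=> t _; rewrite /evA; case: ifP => ot.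
      by case: t ot.
    by congr (nat_of_bool _)%:R; lia.
  + move=> t _; rewrite /evC; case: ifP => ot /=; first by case: t ot.
    by rewrite addr0; congr (nat_of_bool _)%:R; lia.
have fl m : occ m (fun t => (t == m.-1)%:R).
  apply: occ_last => [|t tm]; first by rewrite eqxx.
  by rewrite (_ : (_ == _) = false) //; lia.
(* The final 1 stands at place [N - 1]: an even place for odd [N], giving [evA] and [evC], and an
   odd one for even [N], giving [evB] and [evD]. *)
have [oN|oN] := boolP (odd N); split; apply/orP.
- left; apply: (img_tup (fl _)) => t tN; rewrite /evA; case: ifP => ot.
    by rewrite (_ : (_ == _) = false) //; lia.
  by congr (nat_of_bool _)%:R; lia.
- left; apply: (img_tup (fl _)) => t tN; rewrite /evC; case: ifP => ot /=.
    by congr (nat_of_bool _)%:R; lia.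
  rewrite (_ : (t./2 == _) = false) ?add0r; last lia.
  by congr (nat_of_bool _)%:R; lia.
- right; apply: (img_tup (fl _)) => t tN; rewrite /evB; case: ifP => ot.
    by congr (nat_of_bool _)%:R; lia.
  by rewrite (_ : (_ == _) = false) //; lia.
- right; apply: (img_tup (fl _)) => t tN; rewrite /evD; case: ifP => ot /=.
    rewrite (_ : (t./2 == _) = false) ?add0r; last lia.
    by congr (nat_of_bool _)%:R; lia.
  by congr (nat_of_bool _)%:R; lia.
Qed.

(** Inclusion-exclusion, with 8 = 1 + 4 + 3 from the overlaps of [evA] with [evB], of [evC] with
    [evD], and of the two unions. *)
Lemma card_blocks_rec : (#|blocks N| + 8 =
  #|blocks (uphalf N)| + #|blocks N./2| +
  #|blocks (uphalf N).+1| + #|blocks N./2.+1|)%N.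
Proof.
have := cardsUI (imgs evA (uphalf N) N) (imgs evB N./2 N).
have := cardsUI (imgs evC (uphalf N).+1 N) (imgs evD N./2.+1 N).
have := cardsUI (imgs evA (uphalf N) N :|: imgs evB N./2 N)
  (imgs evC (uphalf N).+1 N :|: imgs evD N./2.+1 N).
rewrite -blocks_split card_imgs_AB card_imgs_CD card_imgs_ABCD.
rewrite (card_imgs (@faithful_evA N)) (card_imgs (@faithful_evB N)).
rewrite (card_imgs (faithful_evC _)) ?(card_imgs (faithful_evD _)); lia.
Qed.

End Recurrence.

(** * Initial values by exhaustive enumeration of short blocks *)

Fixpoint words n : seq (seq 'F_2) :=
  if n is n'.+1 then [seq x :: s | x <- [:: 0; 1], s <- words n'] else [:: [::]].

Lemma mem_words n s : (s \in words n) = (size s == n).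
Proof.
elim: n s => [|n IH] [|x s] //; first by apply/negbTE/allpairsP => -[[y s'] []].
rewrite [RHS]eqSS -IH; apply/allpairsP/idP => [[[y s'] [_ + [_ ->]]] //|sn].
exists (x, s); split=> //.
by case: (F2_cases x) => ->; rewrite !inE eqxx ?orbT.
Qed.

Definition enumerates N (L : seq (seq 'F_2)) :=
  forall s, s \in L <-> size s = N /\ occ N (nth 0 s).

Lemma card_blocks_enum N L : enumerates N L -> #|blocks N| = size (undup L).
Proof.
move=> LP; rewrite cardE -(size_map val); apply/perm_size/uniq_perm.
- by rewrite map_inj_uniq ?enum_uniq //; exact: val_inj.
- exact: undup_uniq.
move=> s; rewrite mem_undup; apply/mapP/idP => [[b]|/LP [sN oc]].
  by rewrite mem_enum => /blocksP ob ->; apply/LP; rewrite size_tuple.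
have sN' : size s == N by apply/eqP.
by exists (Tuple sN') => //; rewrite mem_enum; apply/blocksP.
Qed.

Definition evseq (ev : (nat -> 'F_2) -> nat -> 'F_2) N (L : seq (seq 'F_2)) :=
  [seq mkseq (ev (nth 0 c)) N | c <- L].

Lemma mem_evseq ev m N L s : faithful ev m N -> enumerates m L ->
  s \in evseq ev N L <-> size s = N /\ img ev m N (nth 0 s).
Proof.
move=> fev LP; split=> [/mapP [c /LP [sc oc] ->]|[sN [c oc e]]].
  rewrite size_mkseq; split=> //; exists (nth 0 c) => // t tN.
  by rewrite nth_mkseq.
apply/mapP; exists (mkseq c m).
  apply/LP; rewrite size_mkseq; split=> //.
  by apply: (occ_ext oc) => t tm; rewrite nth_mkseq.
apply: (@eq_from_nth 'F_2 0) => [|t]; first by rewrite sN size_mkseq.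
rewrite sN => tN; rewrite nth_mkseq // e //.
by have [_ h] := fev c (nth 0 (mkseq c m)); apply: h => // k km; rewrite nth_mkseq.
Qed.

(** A computable form of [occ_split]. It needs no control of the overlaps, since repetitions are
    removed when counting, and so reaches lengths 4 and 5, below the range of the recurrence. *)
Lemma enumerates_step N LA LB LC LD : (1 < N)%N ->
  enumerates (uphalf N) LA -> enumerates N./2 LB ->
  enumerates (uphalf N).+1 LC -> enumerates N./2.+1 LD ->
  enumerates N (evseq evA N LA ++ evseq evB N LB ++
                evseq evC N LC ++ evseq evD N LD).
Proof.
move=> N1 hA hB hC hD s.
have mA := mem_evseq s (@faithful_evA N) hA.
have mB := mem_evseq s (@faithful_evB N) hB.
have mC := mem_evseq s (faithful_evC N1) hC.
have mD := mem_evseq s (faithful_evD (ltnW N1)) hD.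
rewrite !mem_cat; split.
  by case/or4P => [/mA|/mB|/mC|/mD] [sN h]; split=> //; apply/occ_split; tauto.
move=> [sN /occ_split h]; apply/or4P.
case: h => -[] h; [apply: Or41; apply/mA|apply: Or42; apply/mB|
  apply: Or43; apply/mC|apply: Or44; apply/mD]; by split.
Qed.

Lemma enumerates_words n : (n <= 3)%N -> enumerates n (words n).
Proof.
move=> n3 s; rewrite mem_words; split=> [/eqP|[->]] //.
by move=> ->; split=> //; apply: (occ_le n3); exact: occ3.
Qed.

Definition words4 := evseq evA 4 (words 2) ++ evseq evB 4 (words 2) ++
  evseq evC 4 (words 3) ++ evseq evD 4 (words 3).

Lemma enumerates_words4 : enumerates 4 words4.
Proof. by apply: enumerates_step => //; exact: enumerates_words. Qed.

Lemma card_blocks3 : #|blocks 3| = 8%N.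
Proof. by rewrite (card_blocks_enum (@enumerates_words 3 isT)); vm_compute. Qed.

Lemma card_blocks4 : #|blocks 4| = 14%N.
Proof. by rewrite (card_blocks_enum enumerates_words4); vm_compute. Qed.

Lemma card_blocks5 : #|blocks 5| = 25%N.
Proof.
have h : enumerates 5 _ := enumerates_step (N := 5) isT
  (@enumerates_words 3 isT) (@enumerates_words 2 isT) enumerates_words4
  (@enumerates_words 3 isT).
by rewrite (card_blocks_enum h); vm_compute.
Qed.

(** * Closed form *)

Section ClosedForm.
Variable a : nat -> nat.
Hypothesis a_rec : forall N, (6 <= N)%N ->
  (a N + 8 = a (uphalf N) + a N./2 + a (uphalf N).+1 + a N./2.+1)%N.
Hypotheses (a3 : a 3 = 8%N) (a4 : a 4 = 14%N) (a5 : a 5 = 25%N).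

Let a_even m : (3 <= m)%N -> (a m.*2 + 8 = 2 * a m + 2 * a m.+1)%N.
Proof.
move=> m3; have := @a_rec m.*2; rewrite uphalf_double doubleK => ->; lia.
Qed.

Let a_odd m : (3 <= m)%N -> (a m.*2.+1 + 8 = a m + 2 * a m.+1 + a m.+2)%N.
Proof.
move=> m3; have := @a_rec m.*2.+1.
by rewrite /= uphalf_double doubleK => ->; lia.
Qed.

(* With [K = 2 ^ k], both formulas stay valid slightly beyond their natural range,
   which is what lets the recurrence be applied across the breakpoints. *)
Lemma closed_form k n :
  let K := (2 ^ k.+2)%N in
  ((K <= n)%N -> (2 * n <= 3 * K + 4)%N ->
    (48 * a n + 12 * (K * n) + 144 * n =
     72 * (n * n) + 7 * (K * K) + 12 * K + 128 + 72 * odd n)%N) /\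
  ((3 * K <= 2 * n)%N -> (n <= 2 * K + 2)%N ->
    (12 * a n + 5 * (K * K) + 30 * n + 6 * K =
     15 * (n * n) + 6 * (K * n) + 32 + 15 * odd n)%N).
Proof.
elim: k n => [|k IH] n /=.
  (* For [K = 4] the two ranges are [4 <= n <= 8] and [6 <= n <= 10], settled value by value. *)
  have a6 : (a 6 + 8 = 2 * a 3 + 2 * a 4)%N := @a_even 3 isT.
  have a7 : (a 7 + 8 = a 3 + 2 * a 4 + a 5)%N := @a_odd 3 isT.
  have a8 : (a 8 + 8 = 2 * a 4 + 2 * a 5)%N := @a_even 4 isT.
  have a9 : (a 9 + 8 = a 4 + 2 * a 5 + a 6)%N := @a_odd 4 isT.
  have a10 : (a 10 + 8 = 2 * a 5 + 2 * a 6)%N := @a_even 5 isT.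
  split=> n1 n2; have [m4 m10] : (4 <= n)%N /\ (n <= 10)%N by lia.
    by do 11 ?[case: n m4 m10 n1 n2 => [|n] //= m4 m10 n1 n2]; lia.
  by do 11 ?[case: n m4 m10 n1 n2 => [|n] //= m4 m10 n1 n2]; lia.
rewrite expnS; move: IH; move KE : (2 ^ k.+2)%N => K IH.
have K4 : (4 <= K)%N by rewrite -KE !expnS mulnA leq_pmulr // expn_gt0.
(* The parity corrections at [m], [m + 1], [m + 2] become two numbers of sum 1, which keeps the
   final arithmetic linear in them. *)
have parity m : (odd m + odd m.+1 = 1)%N by rewrite /=; case: odd.
rewrite -[n]odd_double_half; move: (n./2) => m; have := parity m.
have [p q] := IH m; have [p' q'] := IH m.+1; have [p'' q''] := IH m.+2.
move: p q p' q' p'' q''; rewrite oddD odd_double addbF oddb /= negbK.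
case: (odd n) => /= p q p' q' p'' q'' o; rewrite ?add1n ?add0n; split=> n1 n2;
  have m3 : (3 <= m)%N by lia.
- have am := a_odd m3; have {p q} e := p ltac:(lia) ltac:(lia).
  have {p' q'} e' := p' ltac:(lia) ltac:(lia).
  have {p'' q''} e'' := p'' ltac:(lia) ltac:(lia).
  by move: (odd m : nat) (~~ odd m : nat) o e e' e'' => o o' /= *; lia.
- have am := a_odd m3; have {p q} e := q ltac:(lia) ltac:(lia).
  have {p' q'} e' := q' ltac:(lia) ltac:(lia).
  have {p'' q''} e'' := q'' ltac:(lia) ltac:(lia).
  by move: (odd m : nat) (~~ odd m : nat) o e e' e'' => o o' /= *; lia.
- have am := a_even m3; have {p q} e := p ltac:(lia) ltac:(lia).
  have {p' q'} e' := p' ltac:(lia) ltac:(lia).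
  by move: (odd m : nat) (~~ odd m : nat) o e e' => o o' /= *; lia.
- have am := a_even m3; have {p q} e := q ltac:(lia) ltac:(lia).
  have {p' q'} e' := q' ltac:(lia) ltac:(lia).
  by move: (odd m : nat) (~~ odd m : nat) o e e' => o o' /= *; lia.
Qed.
End ClosedForm.

(** * Asymptotics *)

Section Asymptotics.
Variables (R : realType) (a : nat -> nat).
Hypothesis a_rec : forall N, (6 <= N)%N ->
  (a N + 8 = a (uphalf N) + a N./2 + a (uphalf N).+1 + a N./2.+1)%N.
Hypotheses (a3 : a 3 = 8%N) (a4 : a 4 = 14%N) (a5 : a 5 = 25%N).

Let ratio (n : nat) : R := (a n)%:R / n%:R ^+ 2.
(** [qleft] and [qright] are the branches of the limit function below and above 2/3. At [y = K / n]
    the left branch is the range [3K/2 <= n <= 2K]. *)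
Let qleft (y : R) : R := 5 / 4 + 1 / 2 * y - 5 / 12 * y ^+ 2.
Let qright (y : R) : R := 3 / 2 - 1 / 4 * y + 7 / 48 * y ^+ 2.

Let natr_eq (m n : nat) : m = n -> m%:R = n%:R :> R.
Proof. by move=> ->. Qed.

(** Divided by [n^2], the closed form is a quadratic in [K / n] minus a linear correction over
    [n^2]. Since [4 <= K <= n], the latter lies between 0 and [3 / n], so the limit function bounds
    the ratio from above. *)
Let qright_approx (K n o b : R) : 4 <= K -> K <= n -> 0 <= o -> o <= 1 ->
  48 * b + 12 * (K * n) + 144 * n =
    72 * (n * n) + 7 * (K * K) + 12 * K + 128 + 72 * o ->
  qright (K / n) - 3 / n <= b / n ^+ 2 <= qright (K / n).
Proof.
rewrite /qright => K4 Kn o0 o1 e.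
have n0 : 0 < n by lra.
have be : b = (72 * n ^+ 2 + 7 * K ^+ 2 + 12 * K + 128 + 72 * o - 12 * K * n
  - 144 * n) / 48 by rewrite !expr2; lra.
have -> : b / n ^+ 2 = 3 / 2 - 1 / 4 * (K / n) + 7 / 48 * (K / n) ^+ 2
   - (3 * n - (12 * K + 128 + 72 * o) / 48) / n ^+ 2.
  by rewrite be; field; lra.
apply/andP; split; last by rewrite gerBl divr_ge0 ?sqr_ge0 //; lra.
  rewrite lerD2l lerN2.
  by rewrite ler_pdivrMr ?exprn_gt0 // expr2 mulrA divfK ?gt_eqF //; lra.
Qed.

Lemma ratio_qright k n : (2 ^ k.+2 <= n)%N -> (2 * n <= 3 * 2 ^ k.+2)%N ->
  let y := (2 ^ k.+2)%:R / n%:R in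
  qright y - 3 / n%:R <= ratio n <= qright y.
Proof.
move=> n1 n2; have [+ _] := closed_form a_rec a3 a4 a5 k n.
have K4 : (4 <= 2 ^ k.+2)%N by rewrite !expnS mulnA leq_pmulr // expn_gt0.
move: (2 ^ k.+2)%N K4 n1 n2 => K K4 n1 n2 /(_ n1) /(_ (leq_trans n2 (leq_addr _ _))).
have : (odd n <= 1)%N by case: odd.
move: (odd n : nat) => o o1 /natr_eq; rewrite !(natrD, natrM) => e.
apply: qright_approx e; rewrite ?(ler_nat R 4) ?(ler_nat R _ 1) ?ler_nat //; lia.
Qed.

Let qleft_approx (K n o b : R) : 4 <= K -> K <= n -> 0 <= o -> o <= 1 ->
  12 * b + 5 * (K * K) + 30 * n + 6 * K =
    15 * (n * n) + 6 * (K * n) + 32 + 15 * o ->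
  qleft (K / n) - 3 / n <= b / n ^+ 2 <= qleft (K / n).
Proof.
rewrite /qleft => K4 Kn o0 o1 e.
have n0 : 0 < n by lra.
have be : b = (15 * n ^+ 2 + 6 * K * n + 32 + 15 * o - 5 * K ^+ 2
  - 30 * n - 6 * K) / 12 by rewrite !expr2; lra.
have -> : b / n ^+ 2 = 5 / 4 + 1 / 2 * (K / n) - 5 / 12 * (K / n) ^+ 2
   - ((30 * n + 6 * K - 32 - 15 * o) / 12) / n ^+ 2.
  by rewrite be; field; lra.
apply/andP; split; last by rewrite gerBl divr_ge0 ?sqr_ge0 //; lra.
  rewrite lerD2l lerN2.
  by rewrite ler_pdivrMr ?exprn_gt0 // expr2 mulrA divfK ?gt_eqF //; lra.
Qed.

Lemma ratio_qleft k n : (3 * 2 ^ k.+2 <= 2 * n)%N -> (n <= 2 * 2 ^ k.+2)%N ->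
  let y := (2 ^ k.+2)%:R / n%:R in
  qleft y - 3 / n%:R <= ratio n <= qleft y.
Proof.
move=> n1 n2; have [_ +] := closed_form a_rec a3 a4 a5 k n.
have K4 : (4 <= 2 ^ k.+2)%N by rewrite !expnS mulnA leq_pmulr // expn_gt0.
move: (2 ^ k.+2)%N K4 n1 n2 => K K4 n1 n2 /(_ n1) /(_ (leq_trans n2 (leq_addr _ _))).
have : (odd n <= 1)%N by case: odd.
move: (odd n : nat) => o o1 /natr_eq; rewrite !(natrD, natrM) => e.
apply: qleft_approx e; rewrite ?(ler_nat R 4) ?(ler_nat R _ 1) ?ler_nat //; lia.
Qed.

Lemma ratio_bounds n : (4 <= n)%N -> 39 / 28 - 3 / n%:R <= ratio n <= 7 / 5.
Proof.
move=> n4; have n0 : 0 < n%:R :> R by rewrite ltr0n; lia.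
have [k k1 k2] : exists2 k, (2 ^ k.+2 <= n)%N & (n <= 2 * 2 ^ k.+2)%N.
  have := trunc_log_bounds (isT : (1 < 2)%N) (leq_trans _ n4 : (0 < n)%N).
  have : (2 <= trunc_log 2 n)%N by apply: trunc_log_max.
  case: trunc_log => [|[|k]] // _ /(_ isT) /andP[h1 h2].
  by exists k => //; rewrite -expnS ltnW.
have K0 : 0 < (2 ^ k.+2)%:R :> R by rewrite ltr0n expn_gt0.
have [n2|/ltnW n2] := leqP (2 * n) (3 * 2 ^ k.+2).
  have /andP[] := ratio_qright k1 n2; rewrite /qright /=.
  have y1 : (2 ^ k.+2)%:R / n%:R <= 1 :> R by rewrite ler_pdivrMr // mul1r ler_nat.
  have y0 : 2 / 3 <= (2 ^ k.+2)%:R / n%:R :> R.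
    have : 2 * n%:R <= 3 * (2 ^ k.+2)%:R :> R by rewrite -!natrM ler_nat.
    by rewrite ler_pdivlMr //; lra.
  move: (_ / n%:R) (3 / n%:R) (ratio n) y1 y0 => y z r y1 y0 h1 h2.
  (* [qright y = 39/28 + 7/48 (y - 6/7)^2] gives the lower bound; by convexity the upper one follows
     from the ends 2/3 and 1. *)
  have := sqr_ge0 (y - 6 / 7); have : 0 <= (1 - y) * (y - 2 / 3).
    by rewrite mulr_ge0 // subr_ge0.
  by move=> *; apply/andP; split; lra.
have /andP[] := ratio_qleft n2 k2; rewrite /qleft /=.
have y1 : (2 ^ k.+2)%:R / n%:R <= 2 / 3 :> R.
  have : 3 * (2 ^ k.+2)%:R <= 2 * n%:R :> R by rewrite -!natrM ler_nat.
  by rewrite ler_pdivrMr //; lra.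
have y0 : 1 / 2 <= (2 ^ k.+2)%:R / n%:R :> R.
  have : n%:R <= 2 * (2 ^ k.+2)%:R :> R by rewrite -!natrM ler_nat.
  by rewrite ler_pdivlMr //; lra.
move: (_ / n%:R) (3 / n%:R) (ratio n) y1 y0 => y z r y1 y0 h1 h2.
(* [qleft y = 7/5 - 5/12 (y - 3/5)^2] gives the upper bound; by concavity the lower one follows from
   the ends 1/2 and 2/3. *)
have := sqr_ge0 (y - 3 / 5); have : 0 <= (2 / 3 - y) * (y - 1 / 2).
  by rewrite mulr_ge0 // subr_ge0.
by move=> *; apply/andP; split; lra.
Qed.

Let geometric_cvg (u : nat -> R) (l : R) :
  (forall k, (2 <= k)%N -> `|u k - l| <= 4 / 2 ^+ k) -> u @ \oo --> l.
Proof.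
move=> h; apply/cvgrPdist_le => e e0.
have e4 : 0 <= 4 / e by rewrite divr_ge0 // ltW.
exists (Num.truncn (4 / e)).+2 => // k /= Mk.
rewrite distrC (le_trans (h k _)) //; first exact: leq_trans Mk.
rewrite ler_pdivrMr ?exprn_gt0 // mulrC -ler_pdivrMr //.
have /andP[_ /ltW/le_trans] := truncn_itv e4; apply.
by rewrite -natrX ler_nat ltnW // (leq_trans Mk) // ltnW // ltn_expl.
Qed.

Let sample (x : R) (k : nat) : nat := Num.truncn (2 ^+ k / x).

Lemma sample_bounds x k : 1 / 2 <= x -> x <= 1 ->
  [/\ (2 ^ k <= sample x k)%N, (sample x k <= 2 * 2 ^ k)%N &
     (sample x k)%:R * x <= 2 ^+ k < (sample x k)%:R * x + 1].
Proof.
move=> x1 x2; have x0 : 0 < x by lra.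
have K0 : 0 < 2 ^+ k :> R by rewrite exprn_gt0.
have y0 : 0 <= 2 ^+ k / x by rewrite divr_ge0 // ltW.
have := truncn_itv y0; rewrite -/(sample x k) => /andP[].
rewrite ler_pdivlMr // ltr_pdivrMr // => h1 h2; split.
- by rewrite truncn_ge_nat // natrX ler_pdivlMr // ler_piMr // ltW.
- by rewrite -(ler_nat R) natrM natrX; nra.
by rewrite h1 /=; move: h2; rewrite -natr1; nra.
Qed.

Let qleft_close (n K x r : R) : 1 / 2 <= x -> x <= 1 -> 1 <= K -> K <= n ->
  n * x <= K < n * x + 1 ->
  qleft (K / n) - 3 / n <= r <= qleft (K / n) -> `|r - qleft x| <= 4 / K.
Proof.
rewrite /qleft => x1 x2 K1 Kn /andP[nK Kx].
have n0 : 0 < n by lra.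
have K0 : 0 < K by lra.
have xy : x <= K / n by rewrite ler_pdivlMr // mulrC.
have yx : K / n - x <= n^-1.
  by rewrite -(ler_pM2r n0) mulrBl divfK ?mulVf ?gt_eqF // mulrC; lra.
have y1 : K / n <= 1 by rewrite ler_pdivrMr // mul1r.
have nK1 : n^-1 <= K^-1 by rewrite lef_pV2.
move: (K / n) xy yx y1 => y xy yx y1.
move: n^-1 K^-1 yx nK1 => z w yx zw /andP[r1 r2].
(* As [1 <= x + y <= 2], the difference [y^2 - x^2] lies between [y - x] and [2 (y - x)]. The branch
   then moves by at most [1 / n], which with the error [3 / n] gives [4 / K]. *)
have s : 0 <= (y - x) * (2 - (x + y)) by rewrite mulr_ge0 //; lra.
have t : 0 <= (y - x) * (x + y - 1) by rewrite mulr_ge0 //; lra.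
by rewrite ler_norml; apply/andP; split; lra.
Qed.

Let qright_close (n K x r : R) : 1 / 2 <= x -> x <= 1 -> 1 <= K -> K <= n ->
  n * x <= K < n * x + 1 ->
  qright (K / n) - 3 / n <= r <= qright (K / n) -> `|r - qright x| <= 4 / K.
Proof.
rewrite /qright => x1 x2 K1 Kn /andP[nK Kx].
have n0 : 0 < n by lra.
have K0 : 0 < K by lra.
have xy : x <= K / n by rewrite ler_pdivlMr // mulrC.
have yx : K / n - x <= n^-1.
  by rewrite -(ler_pM2r n0) mulrBl divfK ?mulVf ?gt_eqF // mulrC; lra.
have y1 : K / n <= 1 by rewrite ler_pdivrMr // mul1r.
have nK1 : n^-1 <= K^-1 by rewrite lef_pV2.
move: (K / n) xy yx y1 => y xy yx y1.
move: n^-1 K^-1 yx nK1 => z w yx zw /andP[r1 r2].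
have s : 0 <= (y - x) * (2 - (x + y)) by rewrite mulr_ge0 //; lra.
have t : 0 <= (y - x) * (x + y - 1) by rewrite mulr_ge0 //; lra.
by rewrite ler_norml; apply/andP; split; lra.
Qed.

Lemma ratio_sample_qleft x : 1 / 2 <= x -> x <= 1 -> x <= 2 / 3 ->
  ratio (sample x k) @[k --> \oo] --> qleft x.
Proof.
move=> x1 x2 x3; apply: geometric_cvg => -[|[|k]] // _.
have [n1 n2 n3] := @sample_bounds x k.+2 x1 x2.
have x0 : 0 < x by lra.
have y0 : 0 <= 2 ^+ k.+2 / x by rewrite divr_ge0 ?exprn_ge0 // ltW.
have k0 : 0 <= 2 ^+ k.+1 :> R by rewrite exprn_ge0.
have n5 : (3 * 2 ^ k.+2 <= 2 * sample x k.+2)%N.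
  (* The breakpoint [3/2 * 2^(k+2)] is the integer [3 * 2^(k+1)], so it survives taking the
     floor. *)
  have : (3 * 2 ^ k.+1 <= sample x k.+2)%N.
    rewrite truncn_ge_nat // natrM natrX ler_pdivlMr // [X in _ <= X]exprS.
    by nra.
  by rewrite [(2 ^ k.+2)%N]expnS; lia.
apply: (qleft_close (n := (sample x k.+2)%:R)) => //.
- by rewrite exprn_ege1 // ler1n.
- by rewrite -natrX ler_nat.
- by have := ratio_qleft n5 n2; rewrite natrX.
Qed.

Lemma ratio_sample_qright x : 1 / 2 <= x -> x <= 1 -> 2 / 3 <= x ->
  ratio (sample x k) @[k --> \oo] --> qright x.
Proof.
move=> x1 x2 x3; apply: geometric_cvg => -[|[|k]] // _.
have [n1 n2 n3] := @sample_bounds x k.+2 x1 x2.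
have x0 : 0 < x by lra.
have n5 : (2 * sample x k.+2 <= 3 * 2 ^ k.+2)%N.
  rewrite -(ler_nat R) (natrM R 2) (natrM R 3) natrX.
  case/andP: n3; have := ler0n R (sample x k.+2).
  move: (_%:R) (2 ^+ _) => n K n0 h1 h2.
  by have : 0 <= n * (x - 2 / 3) by [rewrite mulr_ge0 ?subr_ge0]; lra.
apply: (qright_close (n := (sample x k.+2)%:R)) => //.
- by rewrite exprn_ege1 // ler1n.
- by rewrite -natrX ler_nat.
- by have := ratio_qright n1 n5; rewrite natrX.
Qed.

End Asymptotics.

(** * Upper and lower limits from an eventual bound and a subsequence attaining it *)

Lemma limn_esup_subseq (R : realType) (u : nat -> R) (l : R) (f : nat -> nat) :
  (forall e, 0 < e -> exists M, forall n, (M <= n)%N -> u n <= l + e) ->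
  (forall k, (k <= f k)%N) -> u (f k) @[k --> \oo] --> l ->
  limn_esup (fun n => (u n)%:E) = l%:E.
Proof.
move=> ub fk cv; apply/eqP; rewrite eq_le; apply/andP; split.
  apply/lee_addgt0Pr => e e0; have [M uM] := ub e e0.
  apply: (@le_trans _ _ (ereal_sup [set (u n)%:E | n in [set n | (M <= n)%N]])).
    by apply: ereal_inf_lbound; exists [set n | (M <= n)%N] => //; exists M.
  by apply: ge_ereal_sup => _ [n Mn <-]; rewrite -EFinD lee_fin uM.
apply: le_ereal_inf_tmp => _ [A [M _ MA] <-].
apply/lee_addgt0Pr => e e0.
move/cvgrPdist_le: cv => /(_ e e0) [K _ /(_ (maxn K M)) h].
(* The index [maxn K M] is late enough for the convergence, and [k <= f k] puts its image in the
   tail contained in [A]. *)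
have {}h : l - e <= u (f (maxn K M)).
  by have := h (leq_maxl _ _); rewrite /= ler_norml => /andP[_]; lra.
rewrite -leeBlDr // -EFinB; apply: (@le_trans _ _ (u (f (maxn K M)))%:E).
  by rewrite lee_fin.
apply: ereal_sup_ubound; exists (f (maxn K M)) => //.
by apply: MA; rewrite /= (leq_trans (leq_maxr K M)).
Qed.

Lemma limn_einf_subseq (R : realType) (u : nat -> R) (l : R) (f : nat -> nat) :
  (forall e, 0 < e -> exists M, forall n, (M <= n)%N -> l - e <= u n) ->
  (forall k, (k <= f k)%N) -> u (f k) @[k --> \oo] --> l ->
  limn_einf (fun n => (u n)%:E) = l%:E.
Proof.
move=> lb fk cv; rewrite /limn_einf.
have -> : limn_esup (\- (fun n => (u n)%:E))%E = (- l)%:E; last by rewrite EFinN oppeK.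
apply: (@limn_esup_subseq R (fun n => - u n) (- l) f) => //; last exact: cvgN.
move=> e e0; have [M uM] := lb e e0; exists M => n Mn.
by have := uM n Mn; lra.
Qed.

Theorem theorem2p16 (R : realType) :
  let a : nat -> nat := num_accessible (1 + 'X + 'X^2) 2 in
  let ratio : nat -> R := fun n => (a n)%:R / n%:R ^+ 2 in
  (forall x : R, 1 / 2 <= x -> x <= 1 ->
     let n : nat -> nat := fun k => Num.truncn (2 ^+ k / x) in
     (x <= 2 / 3 ->
        ratio (n k) @[k --> \oo] --> 5 / 4 + 1 / 2 * x - 5 / 12 * x ^+ 2) /\
     (2 / 3 <= x ->
        ratio (n k) @[k --> \oo] --> 3 / 2 - 1 / 4 * x + 7 / 48 * x ^+ 2)) /\
  limn_esup (fun n => (ratio n)%:E) = (7 / 5)%:E /\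
  limn_einf (fun n => (ratio n)%:E) = (39 / 28)%:E.
Proof.
move=> a ratio.
have a_rec N : (6 <= N)%N ->
    (a N + 8 = a (uphalf N) + a N./2 + a (uphalf N).+1 + a N./2.+1)%N.
  by move=> N6; rewrite /a !num_accessibleE card_blocks_rec.
have a3 : a 3 = 8%N by rewrite /a num_accessibleE card_blocks3.
have a4 : a 4 = 14%N by rewrite /a num_accessibleE card_blocks4.
have a5 : a 5 = 25%N by rewrite /a num_accessibleE card_blocks5.
have up := ratio_sample_qleft (R := R) a_rec a3 a4 a5.
have lo := ratio_sample_qright (R := R) a_rec a3 a4 a5.
have bounds := ratio_bounds R a_rec a3 a4 a5.
have large (x : R) : 1 / 2 <= x -> x <= 1 ->
    forall k, (k <= Num.truncn (2 ^+ k / x))%N.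
  move=> x1 x2 k; have [h _ _] := sample_bounds k x1 x2.
  by apply: leq_trans h; rewrite ltnW // ltn_expl.
split.
  by move=> x x1 x2 n; split=> x3; [exact: up|exact: lo].
split.
  (* 3/5 is the maximiser of the left branch, where the value is 7/5. *)
  apply: (limn_esup_subseq (f := fun k => Num.truncn (2 ^+ k / (3 / 5)))).
  - move=> e e0; exists 4%N => n n4; have /andP[_] := bounds n n4.
    by rewrite -/(ratio n); lra.
  - by apply: large; lra.
  rewrite (_ : 7 / 5 = 5 / 4 + 1 / 2 * (3 / 5) - 5 / 12 * (3 / 5) ^+ 2); last by field.
  by apply: up; lra.
(* 6/7 is the minimiser of the right branch, where the value is 39/28. *)
apply: (limn_einf_subseq (f := fun k => Num.truncn (2 ^+ k / (6 / 7)))).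
- move=> e e0; exists (maxn 4 (Num.truncn (3 / e)).+1) => n.
  rewrite geq_max => /andP[n4 ne].
  have /andP[h _] := bounds n n4; apply: le_trans h; rewrite lerD2l lerN2.
  have n0 : 0 < n%:R :> R by rewrite ltr0n (leq_trans _ n4).
  rewrite ler_pdivrMr // mulrC -ler_pdivrMr //.
  have /andP[_ /ltW/le_trans] := truncn_itv (divr_ge0 (ler0n R 3) (ltW e0)).
  by apply; rewrite ler_nat.
- by apply: large; lra.
rewrite (_ : 39 / 28 = 3 / 2 - 1 / 4 * (6 / 7) + 7 / 48 * (6 / 7) ^+ 2); last by field.
by apply: lo; lra.
Qed.
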